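(* Let $f$ be a quadratic symplectic map of $(\mathbb{R}^{2n},\omega)$. Then $f$ can be decomposed as $f=T\circ S$, where $T$ is an affine symplectic map and $S$ is a symplectic quadratic shear. Furthermore, if $S$ is any symplectic quadratic shear of $\mathbb{R}^{2n}$, then there are a symplectic linear map $\lambda$ and a smooth function $V:\mathbb{R}^n\to\mathbb{R}$ such that $$\lambda\circ S\circ\lambda^{-1}(q,p)=(q+\nabla V(p),\,p)\qquad\text{for all }(q,p)\in\mathbb{R}^n\times\mathbb{R}^n.$$
   Context: Here $\omega(v,v')=v^TJv'$ is the standard symplectic form on $\mathbb{R}^{2n}$, with $J=\begin{pmatrix}0&I\\-I&0\end{pmatrix}$. A map $f:\mathbb{R}^{2n}\to\mathbb{R}^{2n}$ is symplectic if $\omega(Df(x)v,Df(x)v')=\omega(v,v')$ for all $x,v,v'\in\mathbb{R}^{2n}$. A map is quadratic if its components are real polynomials of degree at most $2$. A quadratic map in standard form on $\mathbb{R}^m$ is a map $x\mapsto x+\frac12M(x)x$, where $M$ is a linear function from $\mathbb{R}^m$ to real $m\times m$ matrices satisfying $M(x)y=M(y)x$ for all $x,y$. A quadratic shear is a quadratic map in standard form that satisfies $M(x)^2x=0$ for all $x$ (equivalently, it is bijective and its inverse is also quadratic). *)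

(* Defs.v *)
From HB Require Import structures.
From mathcomp Require Import all_boot all_order all_algebra.
(* The notations of mpoly clash with those of MathComp-Analysis. *)
From mathcomp Require Import -(notations) mpoly.
From mathcomp Require Import all_classical all_reals all_analysis.

Set Implicit Arguments.
Unset Strict Implicit.
Unset Printing Implicit Defensive.

Import Order.TTheory GRing.Theory Num.Theory.
Import numFieldNormedType.Exports.

Local Open Scope ring_scope.

Definition Jmx (R : realType) (n : nat) : 'M[R]_(n + n) :=
  block_mx 0 1%:M (- 1%:M) 0.

Definition omega (R : realType) (n : nat) (v w : 'cV[R]_(n + n)) : R :=
  (v^T *m Jmx R n *m w) ord0 ord0.

(* Differentiability is required explicitly: 'd f x is a junk value where f is
   not differentiable. *)
Definition symplectic (R : realType) (n : nat)
    (f : 'cV[R]_(n + n) -> 'cV[R]_(n + n)) : Prop :=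
  forall x, differentiable f x /\
    forall v w, omega ('d f x v) ('d f x w) = omega v w.

(* [msize p] is 1 + the total degree of [p] (and 0 when p = 0). *)
Definition quadratic_map (R : realType) (m : nat)
    (f : 'cV[R]_m -> 'cV[R]_m) : Prop :=
  forall i : 'I_m, exists p : mpoly m R,
    (msize p <= 3)%N /\
    forall x, f x i ord0 = meval (fun j => x j ord0) p.

Definition affine_map (R : realType) (m : nat)
    (f : 'cV[R]_m -> 'cV[R]_m) : Prop :=
  exists (A : {linear 'cV[R]_m -> 'cV[R]_m}) (b : 'cV[R]_m),
    forall x, f x = A x + b.

Definition standard_form (R : realType) (m : nat)
    (M : {linear 'cV[R]_m -> 'M[R]_m}) (f : 'cV[R]_m -> 'cV[R]_m) : Prop :=
  (forall x y, M x *m y = M y *m x) /\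
  (forall x, f x = x + 2^-1 *: (M x *m x)).

(* The symmetry condition makes M unique, so that the existential is harmless. *)
Definition quadratic_shear (R : realType) (m : nat)
    (f : 'cV[R]_m -> 'cV[R]_m) : Prop :=
  exists M : {linear 'cV[R]_m -> 'M[R]_m},
    standard_form M f /\ forall x, M x *m M x *m x = 0.

Definition partial (R : realType) (n : nat) (i : 'I_n)
    (V : 'cV[R]_n -> R) : 'cV[R]_n -> R :=
  fun x => 'D_(delta_mx i ord0) V x.

(* C^infinity: all iterated partial derivatives exist and are continuous. *)
Definition smooth (R : realType) (n : nat) (V : 'cV[R]_n -> R) : Prop :=
  forall s : seq 'I_n, let g := foldr (@partial R n) V s in
    continuous g /\ forall i x, derivable g x (delta_mx i ord0).

Definition grad (R : realType) (n : nat) (V : 'cV[R]_n -> R)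
    (x : 'cV[R]_n) : 'cV[R]_n :=
  \col_i partial i V x.

(* Main.v *)
(** Write f x = c + A x + B(x) x / 2.  Since Df(x) = A + B(x) is symplectic for
    all x, so are A and 1 + M(x) with M = A^-1 B, and f = T o S for
    T x = A x + c and S x = x + M(x) x / 2.  Comparing degrees in x,
    1 + M(x) is symplectic iff J M(x) is symmetric and M(x)^2 = 0; polarization
    and M(x) y = M(y) x then give M(x) M(y) = 0.  So the images of the M(x) span
    an isotropic subspace.  In symplectic coordinates in which a Lagrangian
    containing it is the q-space, S reads (q, p) |-> (q + N(p) p / 2, p) with
    N(p) symmetric and N(p) r = N(r) p, which is the gradient map of
    V p = p^T N(p) p / 6. *)
Require Import Defs.
From HB Require Import structures.
From mathcomp Require Import all_boot all_order all_algebra.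
From mathcomp Require Import -(notations) mpoly.
From mathcomp Require Import all_classical all_reals all_analysis.
From mathcomp Require Import zify ring lra.

Set Implicit Arguments.
Unset Strict Implicit.
Unset Printing Implicit Defensive.

Import Order.TTheory GRing.Theory Num.Theory.
Import numFieldNormedType.Exports.

Local Open Scope ring_scope.

(** * Calculus of polynomial functions *)

(* Stated with an exact expansion so that one lemma differentiates quadratic
   maps ([u = 0]) as well as cubic potentials. *)
Lemma derive_cubic (R : realType) (V W : normedModType R) (f : V -> W)
    (x v : V) (d w u : W) :
  (forall h : R, f (h *: v + x) = f x + h *: d + h ^+ 2 *: w + h ^+ 3 *: u) ->
  'D_v f x = d.
Proof.
move=> fE; apply/cvg_lim => //.
(* [g] extends the difference quotient continuously to h = 0, with value [d] there. *)
pose g (h : R) := d + h *: w + h ^+ 2 *: u.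
have -> : (d = g 0) by rewrite /g expr0n /= !scale0r !addr0.
have gc : (g h @[h --> 0] --> g 0)%classic.
  apply: cvgD; last by apply: cvgZr_tmp; exact: exprn_continuous.
  by apply: cvgD; [exact: cvg_cst|apply: cvgZr_tmp; exact: cvg_id].
have gc' : (g h @[h --> 0^'] --> g 0)%classic by exact: cvg_within_filter gc.
apply: cvg_trans gc'; apply: near_eq_cvg.
near=> h.
have h0 : h != 0 by near: h; exact: nbhs_dnbhs_neq.
rewrite /g /= fE -!addrA [f x + _]addrC -!addrA addNr addr0 !scalerDr !scalerA.
by rewrite mulVf // scale1r [h ^+ 2]expr2 [h ^+ 3]exprS !mulKf ?expr2.
Unshelve. all: by end_near.
Qed.

(** An inductive closure, so that differentiability and stability under [partial] are proved by
    induction; smoothness follows from these two. *)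
Inductive polyfun (R : realType) (m : nat) : ('cV[R]_m -> R) -> Prop :=
| polyfun_cst c : polyfun (fun=> c)
| polyfun_coord i : polyfun (fun x => x i ord0)
| polyfunD f g : polyfun f -> polyfun g -> polyfun (fun x => f x + g x)
| polyfunM f g : polyfun f -> polyfun g -> polyfun (fun x => f x * g x).

Lemma polyfun_sum (R : realType) (m : nat) (I : Type) (r : seq I)
    (F : I -> 'cV[R]_m -> R) :
  (forall i, polyfun (F i)) -> polyfun (fun x => \sum_(i <- r) F i x).
Proof.
move=> polyF; elim: r => [|i r IHr].
  by under eq_fun do rewrite big_nil; exact: polyfun_cst.
by under eq_fun do rewrite big_cons; exact: polyfunD.
Qed.

Lemma colV_sum_delta (R : realType) (m : nat) (x : 'cV[R]_m) :
  x = \sum_k x k ord0 *: delta_mx k ord0.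
Proof.
by rewrite [LHS]matrix_sum_delta; apply: eq_bigr => k _; rewrite big_ord1.
Qed.

Lemma polyfun_linear_entry (R : realType) (m a b : nat)
    (M : {linear 'cV[R]_m -> 'M[R]_(a, b)}) i j :
  polyfun (fun x => M x i j).
Proof.
have -> : (fun x => M x i j) =
    (fun x => \sum_k x k ord0 * M (delta_mx k ord0) i j).
  apply: funext => x; rewrite {1}[x]colV_sum_delta linear_sum summxE.
  by apply: eq_bigr => k _; rewrite linearZ mxE.
apply: polyfun_sum => k.
by apply: polyfunM; [exact: polyfun_coord|exact: polyfun_cst].
Qed.

Lemma polyfun_differentiable (R : realType) (m : nat) (f : 'cV[R]_m -> R) x :
  polyfun f -> differentiable f x.
Proof.
elim=> [c|i|{}f g _ df _ dg|{}f g _ df _ dg].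
- exact: differentiable_cst.
- exact: differentiable_coord.
- exact: differentiableD.
- exact: differentiableM.
Qed.

Lemma polyfun_partial (R : realType) (m : nat) (i : 'I_m) (f : 'cV[R]_m -> R) :
  polyfun f -> polyfun (partial i f).
Proof.
have drv (g : 'cV[R]_m -> R) x : polyfun g -> derivable g x (delta_mx i ord0).
  by move=> /polyfun_differentiable dg; exact: diff_derivable.
rewrite /partial; elim=> [c|k|{}f g pf IHf pg IHg|{}f g pf IHf pg IHg].
- by under eq_fun do rewrite derive_cst; exact: polyfun_cst.
- have -> : (fun x : 'cV[R]_m => 'D_(delta_mx i ord0)
      (fun y : 'cV[R]_m => y k ord0 : R) x) = fun=> (k == i)%:R.
    apply: funext => x.
    apply: (@derive_cubic _ _ _ _ _ _ _ 0 0) => h.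
    by rewrite !mxE !scaler0 !addr0 addrC andbT.
  exact: polyfun_cst.
- under eq_fun => x do rewrite (deriveD (drv _ x pf) (drv _ x pg)).
  exact: polyfunD.
- under eq_fun => x do rewrite (deriveM (drv _ x pf) (drv _ x pg)).
  by apply: polyfunD; exact: polyfunM.
Qed.

Lemma polyfun_smooth (R : realType) (m : nat) (f : 'cV[R]_m -> R) :
  polyfun f -> smooth f.
Proof.
move=> polyf s /=.
have polyg : polyfun (foldr (@partial R m) f s).
  by elim: s => //= i s; exact: polyfun_partial.
split=> [x|i x]; first exact/differentiable_continuous/polyfun_differentiable.
exact/diff_derivable/polyfun_differentiable.
Qed.

Lemma differentiable_colV (R : realType) (V : normedModType R) (m : nat)
    (f : V -> 'cV[R]_m) x :
  (forall i, differentiable (fun y => f y i ord0) x) -> differentiable f x.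
Proof.
move=> df; have -> : f = \sum_i (fun y => f y i ord0 *: delta_mx i ord0).
  by apply: funext => y; rewrite fct_sumE -colV_sum_delta.
by apply: differentiable_sum => i; exact: differentiableZl.
Qed.

(** * Quadratic maps in matrix form *)

(** [Q] is an arbitrary matrix, so that a single [delta_mx j i] represents a product of two
    coordinates; [quadratic_mapP] symmetrizes. *)
Definition quadratic_fun (R : realType) (m : nat) (g : 'cV[R]_m -> R) : Prop :=
  exists (c : R) (a : 'rV[R]_m) (Q : 'M[R]_m),
    forall x, g x = c + (a *m x + x^T *m Q *m x) ord0 ord0.

Lemma quadratic_funD (R : realType) (m : nat) (g h : 'cV[R]_m -> R) :
  quadratic_fun g -> quadratic_fun h -> quadratic_fun (fun x => g x + h x).
Proof.
move=> [c [a [Q gE]]] [d [b [P hE]]]; exists (c + d), (a + b), (Q + P) => x.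
rewrite gE hE !mulmxDr !mulmxDl !mxE; ring.
Qed.

Lemma quadratic_funZ (R : realType) (m : nat) (k : R) (g : 'cV[R]_m -> R) :
  quadratic_fun g -> quadratic_fun (fun x => k * g x).
Proof.
move=> [c [a [Q gE]]]; exists (k * c), (k *: a), (k *: Q) => x.
by rewrite gE -scalemxAr -!scalemxAl -scalerDr [in RHS]mxE mulrDr.
Qed.

Lemma quadratic_fun_monomial (R : realType) (m : nat) (mm : multinom m) :
  (mdeg mm < 3)%N ->
  quadratic_fun (fun x : 'cV[R]_m => \prod_i x i ord0 ^+ mm i).
Proof.
have monE (x : 'cV[R]_m) (k : multinom m) : \prod_i x i ord0 ^+ k i =
    meval (fun i => x i ord0) (mpolyX R k).
  by rewrite mevalX.
have deltaE (x : 'cV[R]_m) i : ((delta_mx 0 i : 'rV_m) *m x) 0 0 = x i ord0.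
  by rewrite -rowE mxE.
move=> mm3.
have [mm0|mm_gt0] := posnP (mdeg mm).
  exists 1, 0, 0 => x; rewrite mulmx0 !mul0mx addr0 mxE addr0.
  move/eqP: mm0; rewrite mdeg_eq0 => /eqP ->.
  by rewrite big1 // => i _; rewrite mnm0E.
have [i mmi0] : exists i, mm i != 0%N.
  apply/existsP; rewrite -negb_forall; apply: contraL mm_gt0 => /forallP mm0.
  rewrite mdegE big1 // => i _; exact/eqP.
(* One variable is split off, which leaves a monomial [k] of degree 1 or 0. *)
have [k mmE] : exists k : multinom m, mm = mnm_add k (mnm1 i).
  by exists (mnm_sub mm (mnm1 i)); rewrite submK // lep1mP.
move: mm3; rewrite mmE mdegD mdeg1 addn1 ltnS ltnS leq_eqVlt.
move=> /orP[/mdeg1P[j /eqP ->]|].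
  exists 0, 0, (delta_mx j i) => x.
  rewrite mul0mx !add0r monE mpolyXD mevalM !mevalXU.
  rewrite -(mul_delta_mx (0 : 'I_1)) !mulmxA -mulmxA mxE big_ord1 deltaE.
  by rewrite -colE !mxE.
rewrite ltnS leqn0 mdeg_eq0 => /eqP ->.
exists 0, (delta_mx 0 i), 0 => x.
by rewrite mulmx0 mul0mx addr0 add0r deltaE monE add0m mevalXU.
Qed.

Lemma quadratic_fun_mpoly (R : realType) (m : nat) (p : mpoly m R) :
  (msize p <= 3)%N ->
  quadratic_fun (fun x : 'cV[R]_m => meval (fun j => x j ord0) p).
Proof.
move=> p3; have : all (fun k => mdeg k < 3)%N (msupp p).
  by apply/allP => k /msize_mdeg_lt /leq_trans; exact.
rewrite (_ : (fun x : 'cV[R]_m => _) = fun x : 'cV[R]_m =>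
  \sum_(k <- msupp p) mcoeff k p * \prod_i x i ord0 ^+ k i) //.
elim: (msupp p) => [|k s IHs] /=.
  by move=> _; exists 0, 0, 0 => x; rewrite big_nil mulmx0 !mul0mx !mxE !addr0.
move=> /andP[k3 /IHs quad_s]; under eq_fun do rewrite big_cons.
by apply: quadratic_funD => //; exact/quadratic_funZ/quadratic_fun_monomial.
Qed.

(** Maps built inside proofs, such as x |-> A^-1 B(x), must carry a linear structure to serve in
    [standard_form] and [quadratic_eq]. *)
Lemma linear_packable (R : realType) (U V : lmodType R) (g : U -> V) :
  linear g -> exists L : {linear U -> V}, L =1 g.
Proof.
move=> lin_g; pose gL := GRing.isLinear.Build R U V _ g lin_g.
by exists (HB.pack_for {linear U -> V} g gL).
Qed.

(** The factor one half and the symmetry of [B] make A + B(x) the derivative at x. *)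
Definition quadratic_eq (R : realType) (m : nat) (f : 'cV[R]_m -> 'cV[R]_m)
    (c : 'cV[R]_m) (A : 'M[R]_m) (B : {linear 'cV[R]_m -> 'M[R]_m}) : Prop :=
  (forall x y, B x *m y = B y *m x) /\
  (forall x, f x = c + A *m x + 2^-1 *: (B x *m x)).

Lemma quadratic_mapP (R : realType) (m : nat) (f : 'cV[R]_m -> 'cV[R]_m) :
  quadratic_map f -> exists c A B, quadratic_eq f c A B.
Proof.
move=> quad_f.
have /fin_all_exists [c /fin_all_exists [a /fin_all_exists [Q fE]]] :
    forall i, quadratic_fun (fun x => f x i ord0).
  move=> i; have [p [p3 fE]] := quad_f i.
  by under eq_fun do rewrite fE; exact: quadratic_fun_mpoly.
(* Row i of B(x) is the transpose of H x, where H = Q_i + Q_i^T is the Hessian of component i; the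
   symmetry of H yields that of [B]. *)
have [|B BE] := @linear_packable R 'cV[R]_m 'M[R]_m
  (fun x => \matrix_(i, j) ((Q i + (Q i)^T) *m x) j ord0).
  move=> k x y; apply/matrixP => i j.
  by rewrite [LHS]mxE mulmxDr -scalemxAr !mxE.
have BxE x y i : (B x *m y) i ord0 = (y^T *m (Q i + (Q i)^T) *m x) ord0 ord0.
  rewrite BE -mulmxA !mxE; apply: eq_bigr => j _.
  by rewrite !mxE mulrC.
have trE (M : 'M[R]_1) : M^T ord0 ord0 = M ord0 ord0 by rewrite mxE.
exists (\col_i c i), (\matrix_(i, j) a i ord0 j), B; split=> x.
  move=> y; apply/matrixP => i j; rewrite (ord1 j) !BxE.
  by rewrite -trE !trmx_mul trmxK !mulmxA linearD /= trmxK addrC.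
apply/colP => i.
have AxE : ((\matrix_(i, j) a i ord0 j) *m x) i ord0 = (a i *m x) ord0 ord0.
  by rewrite !mxE; apply: eq_bigr => j _; rewrite mxE.
transitivity (c i + (a i *m x) ord0 ord0 + 2^-1 * (B x *m x) i ord0); last first.
  by rewrite -AxE !mxE.
have symE : (x^T *m (Q i)^T *m x) ord0 ord0 = (x^T *m Q i *m x) ord0 ord0.
  by rewrite -trE !trmx_mul !trmxK mulmxA.
rewrite fE BxE mulmxDr mulmxDl 2![fun_of_matrix (_ + _) ord0 ord0]mxE symE; lra.
Qed.

Lemma quadratic_eq_differential (R : realType) (m : nat)
    (f : 'cV[R]_m -> 'cV[R]_m) c A B x :
  quadratic_eq f c A B ->
  differentiable f x /\ forall v, 'd f x v = (A + B x) *m v.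
Proof.
move=> [Bsym fE].
have df : differentiable f x.
  apply: differentiable_colV => i; apply: polyfun_differentiable.
  rewrite (_ : (fun y : 'cV[R]_m => _) = fun y : 'cV[R]_m => c i ord0 +
    \sum_j (A i j + 2^-1 * B y i j) * y j ord0); last first.
    apply: funext => y; rewrite fE -addrA mxE; congr (_ + _).
    rewrite !mxE mulr_sumr -big_split /=.
    by apply: eq_bigr => j _; rewrite mulrDl mulrA.
  apply: polyfunD; first exact: polyfun_cst.
  apply: polyfun_sum => j; apply: polyfunM; last exact: polyfun_coord.
  apply: polyfunD; first exact: polyfun_cst.
  by apply: polyfunM; [exact: polyfun_cst|exact: polyfun_linear_entry].
split=> // v; rewrite -deriveE //.
(* The coefficient of h is A v + (B(x) v + B(v) x) / 2, and [Bsym] merges the two cross terms. *)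
apply: (@derive_cubic _ _ _ _ _ _ _ (2^-1 *: (B v *m v)) 0) => h.
rewrite !fE scaler0 addr0 [B _]linearD [B (_ *: _)]linearZ /= !mulmxDr !mulmxDl.
rewrite -!scalemxAr -!scalemxAl (Bsym v x).
move: (A *m v) (A *m x) (B x *m v) (B v *m v) (B x *m x) => a b e g k.
apply/matrixP => i j; rewrite !mxE; lra.
Qed.

(** * Symplectic matrices *)

Lemma mulmx_col_inj (R : realType) (m k : nat) (A B : 'M[R]_(m, k)) :
  (forall v : 'cV[R]_k, A *m v = B *m v) -> A = B.
Proof.
move=> AB; apply/matrixP => i j.
by have /colP/(_ i) := AB (delta_mx j 0); rewrite -!colE !mxE.
Qed.

Lemma Jmx_sqr (R : realType) (n : nat) : Jmx R n *m Jmx R n = - 1%:M.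
Proof.
rewrite mulmx_block !mul0mx !mulmx0 !mulmx1 !mul1mx !add0r !addr0.
by rewrite scalar_mx_block opp_block_mx oppr0.
Qed.

Lemma tr_Jmx (R : realType) (n : nat) : (Jmx R n)^T = - Jmx R n.
Proof.
by rewrite tr_block_mx opp_block_mx !trmx0 linearN /= trmx1 oppr0 opprK.
Qed.

Lemma Jmx_unit (R : realType) (n : nat) : Jmx R n \in unitmx.
Proof.
have /mulmx1_unit[] // : Jmx R n *m - Jmx R n = 1%:M.
by rewrite mulmxN Jmx_sqr opprK.
Qed.

Definition symplectic_mx (R : realType) (n : nat) (A : 'M[R]_(n + n)) : Prop :=
  A^T *m Jmx R n *m A = Jmx R n.

Lemma omega_mulmxP (R : realType) (n : nat) (A : 'M[R]_(n + n)) :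
  (forall v w, omega (A *m v) (A *m w) = omega v w) <-> symplectic_mx A.
Proof.
have omE v w : omega (A *m v) (A *m w) =
    (v^T *m (A^T *m Jmx R n *m A) *m w) 0 0.
  by rewrite /omega trmx_mul !mulmxA.
split=> [Aom|Asp v w]; last by rewrite omE Asp.
apply/matrixP => i j; have := Aom (delta_mx i 0) (delta_mx j 0).
by rewrite omE /omega trmx_delta -!rowE -!colE !mxE.
Qed.

(** Trades the condition on the differential for a matrix identity at each point, which reduces
    symplecticity to algebra. *)
Lemma quadratic_eq_symplectic (R : realType) (n : nat)
    (f : 'cV[R]_(n + n) -> 'cV[R]_(n + n)) c A B :
  quadratic_eq f c A B ->
  symplectic f <-> forall x, symplectic_mx (A + B x).
Proof.
move=> fq; split=> fsp x.
  apply/omega_mulmxP => v w; have [_ dfE] := quadratic_eq_differential x fq.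
  by rewrite -!dfE; have [_ ->] := fsp x.
have [df dfE] := quadratic_eq_differential x fq.
by split=> // v w; rewrite !dfE; move: v w; apply/omega_mulmxP.
Qed.

Lemma symplectic_mx_unit (R : realType) (n : nat) (A : 'M[R]_(n + n)) :
  symplectic_mx A -> A \in unitmx.
Proof.
move=> Asp.
suff /mulmx1_unit[] : (- Jmx R n *m A^T *m Jmx R n) *m A = 1%:M by [].
by rewrite -!mulmxA (mulmxA A^T) Asp mulNmx Jmx_sqr opprK.
Qed.

Lemma symplectic_mxM (R : realType) (n : nat) (A B : 'M[R]_(n + n)) :
  symplectic_mx A -> symplectic_mx B -> symplectic_mx (A *m B).
Proof.
move=> Asp Bsp; rewrite /symplectic_mx trmx_mul -!mulmxA.
by rewrite [A^T *m _]mulmxA [A^T *m _ *m _]mulmxA Asp mulmxA.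
Qed.

Lemma symplectic_mxV (R : realType) (n : nat) (A : 'M[R]_(n + n)) :
  symplectic_mx A -> symplectic_mx (invmx A).
Proof.
move=> Asp; have Au := symplectic_mx_unit Asp.
rewrite /symplectic_mx -{1}Asp !mulmxA -trmx_mul mulmxV // trmx1 mul1mx.
by rewrite -mulmxA mulmxV // mulmx1.
Qed.

(** * Matrices of a symplectic shear *)

Lemma symplectic_shear_mx (R : realType) (n : nat)
    (M : {linear 'cV[R]_(n + n) -> 'M[R]_(n + n)}) :
  (forall x, symplectic_mx (1%:M + M x)) ->
  forall x, (M x)^T *m Jmx R n = - (Jmx R n *m M x) /\ M x *m M x = 0.
Proof.
move=> Msp x.
have expand y : (M y)^T *m Jmx R n + Jmx R n *m M y +
    (M y)^T *m Jmx R n *m M y = 0.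
  have := Msp y; rewrite /symplectic_mx [(_ + _)^T]linearD /= trmx1.
  rewrite !mulmxDr !mulmxDl.
  by rewrite mul1mx !mulmx1 -!addrA => /(canRL (addKr _)); rewrite addNr.
(* Compare the parts of [expand] that are even and odd in x. *)
have quad0 : (M x)^T *m Jmx R n *m M x = 0.
  have := expand (- x); have := expand x.
  rewrite [M (- x)]linearN /= [(- M x)^T]linearN /= !mulmxN !mulNmx opprK.
  move: (_ *m Jmx _ _) (Jmx _ _ *m _) => a b.
  move: (a *m _) => e /matrixP abe /matrixP abe'; apply/matrixP => i j.
  move: (abe i j) (abe' i j); rewrite !mxE; lra.
have skew : (M x)^T *m Jmx R n = - (Jmx R n *m M x).
  by have := expand x; rewrite quad0 addr0 => /eqP; rewrite addr_eq0 => /eqP.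
(* By [skew], [quad0] says J M(x)^2 = 0; a second factor J then removes the first. *)
split=> //; move: quad0; rewrite skew mulNmx => /eqP; rewrite oppr_eq0 => /eqP.
move=> /(congr1 (mulmx (Jmx R n))).
rewrite !mulmxA Jmx_sqr mulNmx mul1mx mulmx0 mulNmx => /eqP.
by rewrite oppr_eq0 => /eqP.
Qed.

Lemma shear_mxM_eq0 (R : realType) (m : nat)
    (M : {linear 'cV[R]_m -> 'M[R]_m}) :
  (forall x y, M x *m y = M y *m x) -> (forall x, M x *m M x = 0) ->
  forall x y, M x *m M y = 0.
Proof.
move=> Msym Msqr x y.
have anti u v : M u *m M v = - (M v *m M u).
  have := Msqr (u + v).
  rewrite linearD /= mulmxDl !mulmxDr !Msqr add0r addr0 => /eqP.
  by rewrite addr_eq0 => /eqP.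
apply: mulmx_col_inj => z; rewrite mul0mx.
(* M u (M v w) is symmetric in (v, w) and antisymmetric in (u, v), hence 0. *)
have anti3 u v w : M u *m (M v *m w) = - (M v *m (M u *m w)).
  by rewrite !mulmxA anti mulNmx.
have : M x *m (M y *m z) = - (M x *m (M y *m z)).
  rewrite {1}anti3 (Msym x z) anti3 opprK (Msym y x) anti3.
  by rewrite (Msym z y).
rewrite -mulmxA; move: (M x *m _) => w wE; apply/colP => i.
by move/colP: wE => /(_ i); rewrite !mxE; lra.
Qed.

(** * Isotropic and Lagrangian subspaces *)

(** Subspaces are row spaces: B J B^T = 0 expresses that the one of [B] is isotropic. *)
Lemma isotropic_submx (R : realType) (n a b : nat) (A : 'M[R]_(a, n + n))
    (B : 'M[R]_(b, n + n)) :
  (A <= B)%MS -> B *m Jmx R n *m B^T = 0 -> A *m Jmx R n *m A^T = 0.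
Proof.
move=> /submxP[D ->] Biso.
by rewrite trmx_mul !mulmxA -!(mulmxA D) Biso mul0mx mulmx0.
Qed.

(** Induction on n - rank W. The symplectic complement of W, here [kermx (Jmx R n *m W^T)], has
    dimension 2n - rank W. If rank W < n, it contains a vector outside W, and adding this vector
    preserves isotropy. *)
Lemma isotropic_extension (R : realType) (n : nat) (W : 'M[R]_(n + n)) :
  W *m Jmx R n *m W^T = 0 ->
  exists L : 'M[R]_(n, n + n),
    [/\ row_free L, (W <= L)%MS & L *m Jmx R n *m L^T = 0].
Proof.
have [k] := ubnP (n - \rank W); elim: k W => // k IHk W Wk Wiso.
have Junit := Jmx_unit R n.
have rkJW : \rank (Jmx R n *m W^T) = \rank W.
  by rewrite -mxrank_tr trmx_mul trmxK mxrankMfree // row_free_unit unitmx_tr.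
have W_ker : (W <= kermx (Jmx R n *m W^T))%MS.
  by apply/sub_kermxP; rewrite mulmxA.
have := mxrankS W_ker; rewrite mxrank_ker rkJW => rkW.
have [Wn|nW] := ltnP (\rank W) n; last first.
  have [L [Lfree LW]] : exists L : 'M[R]_(n, n + n), row_free L /\ (L :=: W)%MS.
    have rkWn : \rank W = n by lia.
    (* The number of rows is generalized to [r] to avoid a cast from [\rank W] to [n]. *)
    have basis r : \rank W = r ->
        exists L : 'M[R]_(r, n + n), row_free L /\ (L :=: W)%MS.
      move=> <-; exists (row_base W).
      by split; [exact: row_base_free|exact: eq_row_base].
    exact: basis.
  by exists L; split=> //; rewrite ?LW //; apply: isotropic_submx Wiso; rewrite LW.
have /row_subPn[i vW] : ~~ (kermx (Jmx R n *m W^T) <= W)%MS.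
  by apply/negP => /mxrankS; rewrite mxrank_ker rkJW; lia.
set v := row i _ in vW.
have vJW : v *m Jmx R n *m W^T = 0.
  by apply/eqP; rewrite -mulmxA; apply/eqP/sub_kermxP/row_sub.
have WJv : W *m Jmx R n *m v^T = 0.
  apply: trmx_inj; rewrite !trmx_mul trmxK tr_Jmx mulNmx mulmxN mulmxA vJW.
  by rewrite oppr0 trmx0.
(* This 1 x 1 matrix equals its transpose, which is its opposite because J is antisymmetric. *)
have vJv : v *m Jmx R n *m v^T = 0.
  have /matrixP/(_ 0 0) : (v *m Jmx R n *m v^T)^T = - (v *m Jmx R n *m v^T).
    by rewrite !trmx_mul trmxK tr_Jmx mulNmx mulmxN mulmxA.
  move: (_ *m _) => a; rewrite !mxE => aE; apply/matrixP => k1 k2.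
  rewrite !ord1 mxE; lra.
have [||L [Lfree WvL Liso]] := IHk (W + v)%MS.
- have : (W < W + v)%MS.
    by rewrite ltmxE addsmxSl addsmx_sub submx_refl.
  by move=> /rank_ltmx; lia.
- apply: (@isotropic_submx _ _ _ _ _ (col_mx W v)); first by rewrite addsmxE.
  rewrite tr_col_mx !mul_col_mx !mul_mx_row Wiso WJv vJW vJv.
  by rewrite -block_mxEv block_mx0.
by exists L; split=> //; apply: submx_trans WvL; exact: addsmxSl.
Qed.

(** If u L L^T = 0, then u L has squared Euclidean norm 0, so it vanishes, and so does u. *)
Lemma row_free_gram_unit (R : realType) (m k : nat) (L : 'M[R]_(m, k)) :
  row_free L -> L *m L^T \in unitmx.
Proof.
move=> Lfree; rewrite -row_free_unit -kermx_eq0; apply/eqP/row_matrixP => i.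
set u := row i _; rewrite row0.
have /(congr1 (mulmx^~ u^T)) : u *m (L *m L^T) = 0 by exact/sub_kermxP/row_sub.
rewrite /= mul0mx mulmxA -mulmxA -trmx_mul => /matrixP/(_ 0 0).
rewrite [LHS]mxE [RHS]mxE; under eq_bigr do rewrite [X in _ * X]mxE -expr2.
move=> /psumr_eq0P uL0.
apply: (row_free_inj Lfree); rewrite /= mul0mx; apply/rowP => j.
rewrite [RHS]mxE; apply/eqP; rewrite -sqrf_eq0.
by apply/eqP/uL0 => // *; exact: sqr_ge0.
Qed.

(* The complement is the image under J of the basis of L that is dual to the
   rows of L for the Euclidean inner product. *)
Lemma lagrangian_frame (R : realType) (n : nat) (L : 'M[R]_(n, n + n)) :
  row_free L -> L *m Jmx R n *m L^T = 0 ->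
  exists Q : 'M[R]_(n + n, n), symplectic_mx (row_mx L^T Q).
Proof.
move=> /row_free_gram_unit Gunit Liso.
pose K := invmx (L *m L^T) *m L.
have KL : K *m L^T = 1%:M by rewrite -mulmxA mulVmx.
have LK : L *m K^T = 1%:M by apply: trmx_inj; rewrite trmx_mul trmxK KL trmx1.
have Kiso : K *m Jmx R n *m K^T = 0.
  by apply: isotropic_submx Liso; exact: submxMl.
exists (K *m Jmx R n)^T.
rewrite /symplectic_mx tr_row_mx !trmxK mul_col_mx mul_col_row Liso.
rewrite trmx_mul tr_Jmx.
have -> : L *m Jmx R n *m (- Jmx R n *m K^T) = 1%:M.
  by rewrite mulmxA mulmxN -mulmxA Jmx_sqr mulmxN opprK mulmx1 LK.
have KJJ : K *m Jmx R n *m Jmx R n = - K.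
  by rewrite -mulmxA Jmx_sqr mulmxN mulmx1.
by rewrite KJJ !mulNmx !mulmxN KL opprK mulmxA Kiso.
Qed.

(** * Decomposition into an affine map and a shear *)

Lemma affine_symplectic (R : realType) (n : nat) (A : 'M[R]_(n + n))
    (c : 'cV[R]_(n + n)) :
  symplectic_mx A -> symplectic (fun x => A *m x + c).
Proof.
move=> Asp; have Aeq : quadratic_eq (fun x => A *m x + c) c A \0.
  by split=> [x y|x]; rewrite /= !mul0mx // scaler0 addr0 addrC.
by apply/(quadratic_eq_symplectic Aeq) => x /=; rewrite addr0.
Qed.

Lemma quadratic_symplectic_decomposition (R : realType) (n : nat)
    (f : 'cV[R]_(n + n) -> 'cV[R]_(n + n)) :
  quadratic_map f -> symplectic f ->
  exists T S : 'cV[R]_(n + n) -> 'cV[R]_(n + n),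
    [/\ affine_map T, symplectic T, quadratic_shear S, symplectic S
      & f = T \o S].
Proof.
move=> /quadratic_mapP[c [A [B fq]]] /(quadratic_eq_symplectic fq) fsp.
have Asp : symplectic_mx A by have := fsp 0; rewrite linear0 addr0.
have Aunit := symplectic_mx_unit Asp.
have [|M ME] := @linear_packable R 'cV[R]_(n + n) 'M[R]_(n + n)
  (fun x => invmx A *m B x).
  by move=> k x y; rewrite linearP mulmxDr -scalemxAr.
have [Bsym fE] := fq.
have Msym x y : M x *m y = M y *m x by rewrite !ME -!mulmxA Bsym.
pose S (x : 'cV[R]_(n + n)) := x + 2^-1 *: (M x *m x).
have Sq : quadratic_eq S 0 1%:M M.
  by split=> // x; rewrite add0r mul1mx.
have Ssp x : symplectic_mx (1%:M + M x).
  (* 1 + A^-1 B(x) = A^-1 (A + B(x)) is a product of symplectic matrices. *)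
  rewrite ME -(mulVmx Aunit) -mulmxDr.
  by apply: symplectic_mxM; [exact: symplectic_mxV|exact: fsp].
exists (fun x => A *m x + c), S; split.
- by exists (mulmx A), c.
- exact: affine_symplectic.
- exists M; split=> // x.
  by have [_ ->] := symplectic_shear_mx Ssp x; rewrite mul0mx.
- exact/(quadratic_eq_symplectic Sq).
apply: funext => x; rewrite fE /= mulmxDr -scalemxAr ME !mulmxA mulmxV // mul1mx.
by rewrite -addrA addrC.
Qed.

(** * Normal form of symplectic shears *)

Lemma cubic_potential (R : realType) (n : nat)
    (N : {linear 'cV[R]_n -> 'M[R]_n}) :
  (forall p r, N p *m r = N r *m p) -> (forall p, (N p)^T = N p) ->
  exists V : 'cV[R]_n -> R,
    smooth V /\ forall p, grad V p = 2^-1 *: (N p *m p).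
Proof.
move=> Nsym Ntr.
(* The potential is V p = t p p p / 6 for the symmetric trilinear form t. *)
pose t (a b c : 'cV[R]_n) : R := (a^T *m (N b *m c)) ord0 ord0.
(* [Nsym] swaps the last two arguments and [Ntr] the outer two. These swaps generate all
   permutations, so linearity in the first argument carries over to the others. *)
have tC23 a b c : t a b c = t a c b by rewrite /t Nsym.
have tC13 a b c : t a b c = t c b a.
  have trE (X : 'M[R]_1) : X ord0 ord0 = X^T ord0 ord0 by rewrite mxE.
  by rewrite /t trE !trmx_mul trmxK Ntr mulmxA.
have tP k a a' b c : t (k *: a + a') b c = k * t a b c + t a' b c.
  by rewrite /t linearP /= mulmxDl -scalemxAl !mxE.
have tP2 k a b b' c : t a (k *: b + b') c = k * t a b c + t a b' c.
  by rewrite tC23 tC13 tP (tC13 b) (tC23 a c b) (tC13 b') (tC23 a c b').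
have tP3 k a b c c' : t a b (k *: c + c') = k * t a b c + t a b c'.
  by rewrite tC13 tP (tC13 c) (tC13 c').
exists (fun p => 6^-1 * t p p p); split.
  apply: polyfun_smooth; apply: polyfunM; first exact: polyfun_cst.
  rewrite (_ : (fun p => _) = fun p : 'cV[R]_n =>
    \sum_i p i ord0 * \sum_j N p i j * p j ord0).
    apply: polyfun_sum => i; apply: polyfunM; first exact: polyfun_coord.
    apply: polyfun_sum => j; apply: polyfunM; last exact: polyfun_coord.
    exact: polyfun_linear_entry.
  apply: funext => p; rewrite /t mxE; apply: eq_bigr => i _.
  by rewrite !mxE.
move=> p; apply/colP => i; rewrite mxE /partial.
have -> : (2^-1 *: (N p *m p)) i ord0 = 2^-1 * t (delta_mx i ord0) p p.
  by rewrite /t trmx_delta -rowE !mxE.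
set v := delta_mx i ord0.
(* By symmetry, t(p + hv, p + hv, p + hv) / 6 has coefficients 3/6, 3/6 and 1/6 at h, h^2 and
   h^3. *)
apply: (@derive_cubic _ _ _ _ _ _ _ (2^-1 * t p v v) (6^-1 * t v v v)) => h.
rewrite !(tP, tP2, tP3) (tC23 p v p) (tC13 p p v) (tC23 v p v).
rewrite (tC13 v v p) /GRing.scale /=; by field.
Qed.

Lemma symplectic_shear_normal_form (R : realType) (n : nat)
    (S : 'cV[R]_(n + n) -> 'cV[R]_(n + n)) :
  quadratic_shear S -> symplectic S ->
  exists (lam : {linear 'cV[R]_(n + n) -> 'cV[R]_(n + n)})
         (lamV : 'cV[R]_(n + n) -> 'cV[R]_(n + n))
         (V : 'cV[R]_n -> R),
    [/\ symplectic lam, cancel lam lamV, cancel lamV lam, smooth V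
      & forall q p : 'cV[R]_n,
          (lam \o S \o lamV) (col_mx q p) = col_mx (q + grad V p) p].
Proof.
move=> [M [[Msym SE] _]] Ssymp.
have Sq : quadratic_eq S 0 1%:M M.
  by split=> // x; rewrite add0r mul1mx.
have Msp : forall x, symplectic_mx (1%:M + M x).
  exact/(quadratic_eq_symplectic Sq).
have Mprop := symplectic_shear_mx Msp.
have MM0 : forall x y, M x *m M y = 0.
  by apply: shear_mxM_eq0 => // x; have [] := Mprop x.
have skew x : (M x)^T *m Jmx R n = - (Jmx R n *m M x) by have [] := Mprop x.
(* The span W of the images of all the M x is isotropic, because M x *m M y = 0;
   a Lagrangian L containing it lies in its symplectic complement, which is the
   common kernel of the M x. *)
pose W := (\sum_i (M (delta_mx i 0))^T)%MS.
have MW x : ((M x)^T <= W)%MS.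
  rewrite [x]colV_sum_delta !linear_sum; apply: summx_sub => i _.
  by rewrite !linearZ scalemx_sub // (sumsmx_sup i).
have Wiso : W *m Jmx R n *m W^T = 0.
  rewrite -mulmxA; apply/sub_kermxP/sumsmx_subP => i _; apply/sub_kermxP.
  apply: trmx_inj; rewrite !trmx_mul !trmxK trmx0 tr_Jmx -mulmxA mulNmx mulmxN.
  apply/eqP; rewrite oppr_eq0; apply/eqP/sub_kermxP/sumsmx_subP => j _.
  by apply/sub_kermxP; rewrite mulmxA skew mulNmx -mulmxA MM0 mulmx0 oppr0.
have [L [Lfree WL Liso]] := isotropic_extension Wiso.
have [Q Psp] := lagrangian_frame Lfree Liso.
(* [P] maps the q-space onto [L]; conjugating S by [P] turns [M] into the [M'] below. *)
set P := row_mx _ _ in Psp; have Punit := symplectic_mx_unit Psp.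
(* Up to sign J M(y) L^T is M(y)^T J L^T, where the rows of M(y)^T lie in the isotropic [L]. *)
have ML0 y : M y *m L^T = 0.
  have /submxP[D MD] := submx_trans (MW y) WL.
  apply: (can_inj (mulKmx (Jmx_unit R n))); rewrite mulmx0 mulmxA.
  apply: oppr_inj; rewrite -mulNmx -skew MD -!mulmxA (mulmxA L) Liso mulmx0.
  by rewrite oppr0.
have [|M' M'E] := @linear_packable R 'cV[R]_(n + n) 'M[R]_(n + n)
  (fun x => invmx P *m M (P *m x) *m P).
  move=> k x y; rewrite mulmxDr -scalemxAr linearP mulmxDr mulmxDl.
  by rewrite -scalemxAr -scalemxAl.
have M'sym x y : M' x *m y = M' y *m x.
  by rewrite !M'E -!mulmxA Msym.
(* 1 + M'(x) is the conjugate of 1 + M(P x) by the symplectic [P], so [symplectic_shear_mx] applies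
   to [M'] too. *)
have M'skew x : (M' x)^T *m Jmx R n = - (Jmx R n *m M' x).
  have [] // := @symplectic_shear_mx _ _ M' _ x => y; rewrite M'E.
  have -> : 1%:M + invmx P *m M (P *m y) *m P =
      invmx P *m (1%:M + M (P *m y)) *m P.
    by rewrite mulmxDr mulmx1 mulmxDl mulVmx.
  apply: symplectic_mxM => //.
  apply: symplectic_mxM; first exact: symplectic_mxV.
  exact: Msp.
(* The image of M(P x) lies in [L], which P^-1 sends to the q-space: the lower rows of M'(x) vanish.
   By [ML0] the left columns vanish as well, leaving only the upper right block. *)
have M'd x : dsubmx (M' x) = 0.
  have /submxP[D MD] := submx_trans (MW (P *m x)) WL.
  have -> : M' x = col_mx D^T 0 *m P.
    rewrite M'E; congr (_ *m _); apply: (can_inj (mulKmx Punit)).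
    by rewrite mulKVmx // mul_row_col mulmx0 addr0 -trmx_mul -MD trmxK.
  by rewrite mul_col_mx mul0mx col_mxKd.
have M'q x (q : 'cV[R]_n) : M' x *m col_mx q 0 = 0.
  have Pq : P *m col_mx q 0 = L^T *m q by rewrite mul_row_col mulmx0 addr0.
  by rewrite M'E -!mulmxA Pq (mulmxA (M _)) ML0 mul0mx mulmx0.
have M'l x : lsubmx (M' x) = 0.
  apply: mulmx_col_inj => q; rewrite mul0mx -(M'q x q).
  by rewrite -[M' x in RHS]hsubmxK mul_row_col mulmx0 addr0.
have M'block x : M' x = block_mx 0 (ursubmx (M' x)) 0 0.
  rewrite -[LHS]submxK /ulsubmx /dlsubmx /drsubmx M'd linear0.
  have -> : lsubmx (usubmx (M' x)) = usubmx (lsubmx (M' x)).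
    by apply/matrixP => i j; rewrite !mxE.
  by rewrite M'l !linear0.
(* By symmetry the q-space, killed by every M'(x), is also killed by [M'] itself, so M'(q, p)
   depends on p alone. *)
have M'q0 (q : 'cV[R]_n) : M' (col_mx q 0) = 0.
  by apply: mulmx_col_inj => y; rewrite M'sym M'q mul0mx.
have [|N NE] := @linear_packable R 'cV[R]_n 'M[R]_n
  (fun p => ursubmx (M' (col_mx 0 p))).
  move=> k x y; rewrite -!linearP /=; congr (ursubmx (M' _)).
  by rewrite scale_col_mx add_col_mx scaler0 addr0.
have M'N p (q r : 'cV[R]_n) : M' (col_mx 0 p) *m col_mx q r = col_mx (N p *m r) 0.
  by rewrite M'block -NE mul_block_col !mul0mx add0r addr0.
have Nsym p r : N p *m r = N r *m p.
  by have := M'sym (col_mx 0 p) (col_mx 0 r); rewrite !M'N => /eq_col_mx[].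
(* The lower right block of [M'skew] is this identity. *)
have Ntr p : (N p)^T = N p.
  have := M'skew (col_mx 0 p); rewrite M'block -NE tr_block_mx !mulmx_block.
  rewrite !trmx0 !mul0mx !mulmx0 !mulmx1 !mulNmx !mul1mx !add0r !addr0.
  by rewrite opp_block_mx opprK => /eq_block_mx[].
have [V [Vsmooth Vgrad]] := cubic_potential Nsym Ntr.
exists (mulmx (invmx P)), (mulmx P), V; split.
- have := affine_symplectic 0 (symplectic_mxV Psp).
  by under [X in symplectic X -> _]eq_fun do rewrite addr0.
- exact: mulKVmx.
- exact: mulKmx.
- exact: Vsmooth.
move=> q p; rewrite /= SE mulmxDr mulKmx // -scalemxAr !mulmxA -M'E.
have -> : M' (col_mx q p) = M' (col_mx 0 p).
  have -> : col_mx q p = col_mx q 0 + col_mx 0 p.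
    by rewrite add_col_mx addr0 add0r.
  by rewrite linearD /= M'q0 add0r.
by rewrite M'N Vgrad scale_col_mx scaler0 add_col_mx addr0.
Qed.

Theorem theorem3p1 (R : realType) (n : nat) :
  (forall f : 'cV[R]_(n + n) -> 'cV[R]_(n + n),
     quadratic_map f -> symplectic f ->
     exists T S : 'cV[R]_(n + n) -> 'cV[R]_(n + n),
       [/\ affine_map T, symplectic T, quadratic_shear S, symplectic S
         & f = T \o S]) /\
  (forall S : 'cV[R]_(n + n) -> 'cV[R]_(n + n),
     quadratic_shear S -> symplectic S ->
     exists (lam : {linear 'cV[R]_(n + n) -> 'cV[R]_(n + n)})
            (lamV : 'cV[R]_(n + n) -> 'cV[R]_(n + n))
            (V : 'cV[R]_n -> R),
       [/\ symplectic lam, cancel lam lamV, cancel lamV lam, smooth V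
         & forall q p : 'cV[R]_n,
             (lam \o S \o lamV) (col_mx q p) = col_mx (q + grad V p) p]).
Proof.
split; first exact: quadratic_symplectic_decomposition.
exact: symplectic_shear_normal_form.
Qed.
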